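(* Let $n\ge 2$ and let $A$ be an $n\times n$ symmetric $0$-$1$ matrix with zero diagonal. Let $\bar A=J-I-A$, where $J$ is the $n\times n$ all-one matrix and $I$ is the identity matrix. Then $$\alpha(A)+\alpha(\bar A)\ge 1,$$ or equivalently, $$\beta(A)-\alpha(A)\le n-1.$$
   Context: For a symmetric $0$-$1$ matrix $M$ of order $n$ with zero diagonal, its Laplacian matrix is $L_M=\operatorname{diag}(Me)-M$, where $e=(1,\ldots,1)^T\in\mathbb{R}^n$. The eigenvalues of $L_M$, counted with multiplicity, are denoted $0=\mu_n(L_M)\le\mu_{n-1}(L_M)\le\cdots\le\mu_1(L_M)$. Set $\alpha(M)=\mu_{n-1}(L_M)$ (the second smallest eigenvalue) and $\beta(M)=\mu_1(L_M)$ (the largest eigenvalue). *)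

(* Defs.v *)
From mathcomp Require Import all_boot all_order all_algebra.
From mathcomp Require Import reals polyrcf.

Set Implicit Arguments.
Unset Strict Implicit.
Unset Printing Implicit Defensive.

Import Order.TTheory GRing.Theory Num.Theory.

Local Open Scope ring_scope.

Definition zero_one_mx (R : realType) (n : nat) (M : 'M[R]_n) : Prop :=
  forall i j, M i j = 0 \/ M i j = 1.

Definition zero_diag_mx (R : realType) (n : nat) (M : 'M[R]_n) : Prop :=
  forall i, M i i = 0.

Definition laplacian (R : realType) (n : nat) (M : 'M[R]_n) : 'M[R]_n :=
  diag_mx (M *m const_mx 1 : 'cV_n)^T - M.

Definition compl_mx (R : realType) (n : nat) (M : 'M[R]_n) : 'M[R]_n :=
  const_mx 1 - 1%:M - M.

(* The real eigenvalues in nondecreasing order, each repeated according to its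
   multiplicity as a root of the characteristic polynomial (for a symmetric
   matrix there are n of them). [rootsR p] is the increasing list of the
   distinct roots of p. *)
Definition eigenvalues (R : realType) (n : nat) (M : 'M[R]_n) : seq R :=
  flatten [seq nseq (mup x (char_poly M)) x | x <- rootsR (char_poly M)].

(* [mu k M] is the k-th largest eigenvalue, counted from k = 1, so that
   mu n M <= ... <= mu 1 M when M is symmetric of order n. *)
Definition mu (k : nat) (R : realType) (n : nat) (M : 'M[R]_n) : R :=
  nth 0 (rev (eigenvalues M)) k.-1.

Definition alpha (R : realType) (n : nat) (M : 'M[R]_n) : R :=
  mu n.-1 (laplacian M).

Definition beta (R : realType) (n : nat) (M : 'M[R]_n) : R :=
  mu 1 (laplacian M).

Lemma eigenvalues_unique (R : realType) (n : nat) (M : 'M[R]_n) (s : seq R) :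
  sorted <=%R s -> char_poly M = \prod_(x <- s) ('X - x%:P) ->
  eigenvalues M = s.
Proof.
move=> s_sorted Ms.
have p0 : char_poly M != 0 by apply: monic_neq0; apply: char_poly_monic.
have rU : uniq (rootsR (char_poly M)) by exact: uniq_roots.
have rS : sorted <%R (rootsR (char_poly M)) by exact: sorted_roots.
apply: le_sorted_eq => //; rewrite /eigenvalues.
- have := sub_sorted (@ltW _ R) rS.
  elim: (rootsR _) => [|x r IHr] //= xr.
  have xrP : all (>= x) r by apply: order_path_min xr; exact: le_trans.
  rewrite sorted_pairwise; last exact: le_trans.
  rewrite pairwise_cat -!sorted_pairwise; try exact: le_trans.
  rewrite IHr ?(path_sorted xr) // andbT; apply/andP; split.
    apply/allrelP=> y z /nseqP[-> _] /flattenP[t /mapP[w wr ->]] /nseqP[-> _].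
    exact: (allP xrP).
  by elim: (mup _ _) => [|[|k] IHk] //=; rewrite lexx.
apply/allP => x _ /=; rewrite count_flatten -map_comp /=.
have -> : count_mem x s = mup x (char_poly M) by rewrite Ms mu_prod_XsubC.
rewrite sumnE big_map.
under eq_bigr => y _ do rewrite /= count_nseq /=.
have [xr|xr] := boolP (x \in rootsR (char_poly M)).
  rewrite (bigD1_seq x) //= eqxx mul1n big1 ?addn0 //.
  by move=> y yx; rewrite (negPf yx).
rewrite big_seq big1.
  have := roots_on_rootsR p0 x; rewrite (negPf xr) in_itv /= => rx.
  by rewrite mupNroot // rx.
by move=> y yr; case: eqP => // yx; rewrite -yx yr in xr.
Qed.

(* Main.v *)
Require Import Defs.
From mathcomp Require Import all_boot all_order all_algebra.
From mathcomp Require Import reals.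
From mathcomp Require Import complex spectral sesquilinear ring lra.

(* Call an eigenvalue of a Laplacian nontrivial if it has an eigenvector
   orthogonal to e. We have L_A + L_Abar = nI - J, so beta(A) = n - b for some
   nontrivial eigenvalue b of L_Abar, and both claims follow from: a + b >= 1
   for all nontrivial eigenvalues a of L_A and b of L_Abar. Suppose a + b < 1,
   with eigenvectors x and y.

   Let x be maximal at k and minimal at l. The equation
   sum_{j ~ k} (x_k - x_j) = a x_k has nonnegative terms, so
   x_j >= (1 - a) x_k > 0 on the set K of neighbours of k, and likewise
   x_j <= (1 - a) x_l < 0 on the set L of neighbours of l; so K and L are
   disjoint and k, l are not adjacent. In the same way, for r and s where y is
   maximal and minimal, the sets S and T of non-neighbours (in A) of r and of s
   are disjoint and r, s are adjacent. Hence, up to exchanging r and s,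
   r is in K and s is in L, while l is in S and k is in T.

   The equation at r in the complement reads
   sum_{j in S} (x_r - x_j) = (n - a) x_r. Bounding x_j from below by
   (1 - a) x_k on S meet K and by x_l on S \ K gives
   (1 - a) x_k (n - a - |S \ K|) <= |S \ K| |x_l|. With its analogue at s it
   yields (|S \ K| + |T \ L|) (2 - a) >= 2 (n - a) (1 - a). Exchanging the roles
   of the two graphs, (|L \ S| + |K \ T|) (2 - b) >= 2 (n - b) (1 - b). These four
   sets are pairwise disjoint, so their sizes add up to at most n, which is
   incompatible with a + b < 1. *)

Import Order.TTheory GRing.Theory Num.Theory.

Local Open Scope ring_scope.

(** * Laplacian eigenvectors on a finite graph and their extremal entries *)

Definition is_eigenfun {R : realFieldType} {T : finType} (e : rel T) (a : R)
    (x : T -> R) :=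
  (forall i, \sum_(j | e i j) (x i - x j) = a * x i) /\ \sum_i x i = 0.

(** A minimum of [x] is treated as a peak of [\- x], so the same lemmas serve both extremes. *)
Definition is_peak {R : realFieldType} {T : finType} (e : rel T) (a : R)
    (x : T -> R) (k : T) :=
  [/\ 0 < x k, forall j, x j <= x k & forall j, e k j -> (1 - a) * x k <= x j].

Definition co_rel {T : finType} (e e' : rel T) :=
  forall i j, e' i j = (i != j) && ~~ e i j.

Lemma is_eigenfunN {R : realFieldType} {T : finType} (e : rel T) (a : R)
    (x : T -> R) : is_eigenfun e a x -> is_eigenfun e a (\- x).
Proof.
move=> [xE x0]; split=> [i|]; last by rewrite sumrN x0 oppr0.
rewrite mulrN -xE -sumrN; apply: eq_bigr => j _ /=; ring.
Qed.

(** The maximum is positive because [x] is nonzero with sum zero. There all terms of the eigenvalue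
    equation are nonnegative, so each is at most [a * x k]. *)
Lemma peak_exists {R : realFieldType} {T : finType} (e : rel T) (a : R)
    (x : T -> R) (i0 : T) :
  is_eigenfun e a x -> x i0 != 0 -> 0 <= a /\ exists k, is_peak e a x k.
Proof.
move=> [xE x0] xi0; pose k := [arg max_(i > i0) x i]%O.
have xk j : x j <= x k by rewrite /k; case: arg_maxP => // i _; apply.
have xk0 : 0 < x k.
  rewrite ltNge; apply/negP => xk0.
  have /psumr_eq0P xN0 : forall i, true -> 0 <= - x i.
    by move=> i _; rewrite oppr_ge0 (le_trans (xk i)).
  by move/eqP: xi0; apply; apply/eqP; rewrite -oppr_eq0 xN0 ?sumrN ?x0 ?oppr0.
have d0 j : e k j -> 0 <= x k - x j by rewrite subr_ge0.
have a0 : 0 <= a by rewrite -(pmulr_lge0 _ xk0) -xE sumr_ge0.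
split=> //; exists k; split=> // j ekj.
have := xE k; rewrite (bigD1 j) //= => xkE.
have : 0 <= \sum_(i | e k i && (i != j)) (x k - x i).
  by apply: sumr_ge0 => i /andP[/d0].
lra.
Qed.

Lemma peak_coneighbors {R : realFieldType} {T : finType} (e e' : rel T)
    (a q : R) (x : T -> R) (k r : T) :
    co_rel e' e -> co_rel e e' -> is_eigenfun e a x -> is_peak e a x k ->
    a < 1 -> (forall j, - q <= x j) -> e k r ->
  (1 - a) * x k * (#|T|%:R - a - #|[pred j | e' r j && ~~ e k j]|%:R)
    <= #|[pred j | e' r j && ~~ e k j]|%:R * q.
Proof.
move=> e'E eE [xE x0] [xk0 _ xK] a1 xq ekr.
have xr := xK r ekr.
(* Subtract the equation for [e] at [r] from the sum over all [j], which is [#|T|%:R * x r]. *)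
have sumS : \sum_(j | e' r j) (x r - x j) = (#|T|%:R - a) * x r.
  have : \sum_j (x r - x j) = #|T|%:R * x r.
    by rewrite sumrB x0 subr0 sumr_const mulr_natl.
  rewrite (bigID (e r)) /= xE (bigD1 r) /=; last by rewrite e'E eqxx.
  rewrite (eq_bigl (e' r)); last by move=> j; rewrite eE andbC eq_sym.
  by move=> h; rewrite mulrBl -h; ring.
have := leqnn #|[pred j | e' r j]|; set s := #|[pred j | e' r j]| in sumS *.
have sn : (s.+1 <= #|T|)%N.
  rewrite /s -cardsT (cardsD1 r) inE add1n ltnS; apply: subset_leq_card.
  by apply/subsetP => j; rewrite !inE eE andbT eq_sym => /andP[].
set s2 := #|_|; pose s1 := #|[pred j | e' r j && e k j]|.
have s12 : (s1 + s2)%N = s.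
  rewrite /s /s1 /s2 -!sum1_card [RHS](bigID (e k)) /=.
  by congr addn; apply: eq_bigl => j; rewrite !inE.
have : \sum_(j | e' r j) (x r - x j)
    <= s1%:R * (x r - (1 - a) * x k) + s2%:R * (x r + q).
  rewrite (bigID (e k)) /=; apply: lerD.
    rewrite mulr_natl -sumr_const; apply: ler_sum => j /andP[_ /xK]; lra.
  rewrite mulr_natl -sumr_const; apply: ler_sum => j _; have := xq j; lra.
rewrite sumS => h _.
(* The first factor is positive, as [r] is not its own neighbour and [a < 1]; so [x r] in [h] may be
   replaced by its lower bound [(1 - a) * x k]. *)
have : 0 <= (#|T|%:R - a - s1%:R - s2%:R) * (x r - (1 - a) * x k).
  apply: mulr_ge0; last lra.
  have : (s1 + s2).+1%:R <= #|T|%:R :> R by rewrite ler_nat s12.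
  rewrite -addn1 !natrD; lra.
nra.
Qed.

(** Solving for [a1] and [a2] bounds each below by a fraction; the excess of the resulting bound
    over the claim is a nonnegative multiple of [(p - q) ^+ 2]. In use, [u] is [1 - a], and [p], [q]
    are the height of the maximum and the depth of the minimum. *)
Lemma coneighbors_lower_bound {R : realFieldType} (N u p q a1 a2 : R) :
    0 <= N -> 0 < u <= 1 -> 0 < p -> 0 < q ->
    u * p * (N - a1) <= a1 * q -> u * q * (N - a2) <= a2 * p ->
  2 * N * u <= (a1 + a2) * (1 + u).
Proof.
move=> N0 /andP[u0 u1] p0 q0 h1 h2.
have d1 : 0 < q + u * p by nra.
have d2 : 0 < p + u * q by nra.
have {}h1 : u * p * N / (q + u * p) <= a1 by rewrite ler_pdivrMr //; lra.
have {}h2 : u * q * N / (p + u * q) <= a2 by rewrite ler_pdivrMr //; lra.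
apply: (@le_trans _ _
  ((u * p * N / (q + u * p) + u * q * N / (p + u * q)) * (1 + u))); last first.
  by rewrite ler_pM2r ?lerD //; lra.
rewrite -subr_ge0.
have -> : (u * p * N / (q + u * p) + u * q * N / (p + u * q)) * (1 + u)
    - 2 * N * u
  = N * u * ((1 - u) * (p - q) ^+ 2) / ((q + u * p) * (p + u * q)).
  by field; rewrite !gt_eqF.
apply: divr_ge0; last by rewrite ltW ?mulr_gt0.
by apply: mulr_ge0; [exact: mulr_ge0 (ltW u0)|apply: mulr_ge0; [lra|exact: sqr_ge0]].
Qed.

Lemma peaks_coneighbors {R : realFieldType} {T : finType} (e e' : rel T)
    (a : R) (x : T -> R) (k l r s : T) :
    co_rel e' e -> co_rel e e' -> is_eigenfun e a x ->
    is_peak e a x k -> is_peak e a (\- x) l -> 0 <= a < 1 -> e k r -> e l s ->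
  2 * (#|T|%:R - a) * (1 - a) <=
    (#|[pred j | e' r j && ~~ e k j]|%:R
       + #|[pred j | e' s j && ~~ e l j]|%:R) * (2 - a).
Proof.
move=> e'E eE xE kP lP /andP[a0 a1] ekr els.
have [xk0 xk _] := kP; have [xl0 xl _] := lP.
have -> : 2 - a = 1 + (1 - a) by ring.
apply: (@coneighbors_lower_bound _ _ _ (x k) (- x l)) => //; try lra.
- have : 1 <= #|T|%:R :> R by rewrite ler1n; apply/card_gt0P; exists k.
  lra.
- apply: peak_coneighbors => //= j; have /= := xl j; lra.
- apply: (@peak_coneighbors _ _ _ _ _ _ (\- x)) => //=.
    exact: is_eigenfunN.
  by move=> j; rewrite lerN2.
Qed.

(** Any two of the four sets are separated by a set and its complement or by a hypothesis, so each
    point is counted at most once. *)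
Lemma crossing_counts {T : finType} (P Q P' Q' : pred T) :
    (forall j, ~~ (P j && Q j)) -> (forall j, ~~ (P' j && Q' j)) ->
  (#|[pred j | P' j && ~~ P j]| + #|[pred j | Q' j && ~~ Q j]|
   + (#|[pred j | Q j && ~~ P' j]| + #|[pred j | P j && ~~ Q' j]|) <= #|T|)%N.
Proof.
move=> PQ PQ'; rewrite -!sum1_card !(big_mkcond (fun j => j \in _)) -!big_split.
apply: leq_sum => j _; have := PQ j; have := PQ' j; rewrite !inE.
by case: (P j) (Q j) (P' j) (Q' j) => [] [] [] [].
Qed.

Lemma peaks_incompatible {R : realFieldType} (n a b A B : R) :
    2 <= n -> 0 <= a -> 0 <= b -> a + b < 1 ->
    2 * (n - a) * (1 - a) <= A * (2 - a) ->
    2 * (n - b) * (1 - b) <= B * (2 - b) ->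
  n < A + B.
Proof.
move=> n2 a0 b0 ab hA hB.
suff : n * ((2 - a) * (2 - b)) < (A + B) * ((2 - a) * (2 - b)).
  by rewrite ltr_pM2r // mulr_gt0; lra.
have hA' : 2 * (n - a) * (1 - a) * (2 - b) <= A * (2 - a) * (2 - b).
  by apply: ler_wpM2r => //; lra.
have hB' : 2 * (n - b) * (1 - b) * (2 - a) <= B * (2 - b) * (2 - a).
  by apply: ler_wpM2r => //; lra.
have h0 : 0 <= a * b by exact: mulr_ge0.
(* With denominators cleared, the gap is affine in [n]. Expanded around [n = 2], its linear part is
   bounded in [h1] and its value at 2 in [h2]. *)
have h1 : 0 <= (n - 2) * (4 * (1 - a - b) + 3 * (a * b)).
  by apply: mulr_ge0; lra.
have h2 : 0 < (1 - a - b) * (8 - 4 * (a + b) + 2 * (a * b)).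
  by apply: mulr_gt0; lra.
lra.
Qed.

(** * Eigenvalues of two complementary graphs *)

Lemma eigenvalue_sum_ge1_adj {R : realFieldType} {T : finType}
    (e e' : rel T) (a b : R) (x y : T -> R) (k l r s : T) :
    co_rel e' e -> co_rel e e' -> symmetric e -> (2 <= #|T|)%N ->
    is_eigenfun e a x -> is_eigenfun e' b y -> 0 <= a -> 0 <= b ->
    is_peak e a x k -> is_peak e a (\- x) l ->
    is_peak e' b y r -> is_peak e' b (\- y) s ->
  e k r -> 1 <= a + b.
Proof.
move=> e'E eE esym T2 xE yE a0 b0 kP lP rP sP ekr; rewrite leNgt; apply/negP=> ab.
have [xk0 _ xK] := kP; have [xl0 _ xL] := lP.
have [yr0 _ yR] := rP; have [ys0 _ yS] := sP; rewrite /= in xl0 xL ys0 yS.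
have KL j : ~~ (e k j && e l j).
  by apply/negP => /andP[/xK h1 /xL h2]; nra.
have RS j : ~~ (e' r j && e' s j).
  by apply/negP => /andP[/yR h1 /yS h2]; nra.
have ekl : ~~ e k l by apply/negP => /xK h; nra.
have e'rs : ~~ e' r s by apply/negP => /yR h; nra.
have rl : e' r l.
  rewrite eE; apply/andP; split; first by apply: contraNneq ekl => <-.
  by rewrite esym; have := KL r; rewrite ekr.
have els : e l s.
  rewrite esym e'E; apply/andP; split; first by apply: contraNneq e'rs => ->.
  by have := RS l; rewrite rl.
have sk : e' s k.
  rewrite eE; apply/andP; split.
    by apply: contraNneq ekl => <-; rewrite esym.
  by rewrite esym; have := KL s; rewrite els andbT.
have hA := peaks_coneighbors e e' a x k l r s e'E eE xE kP lP.
(* In the complement [r] is paired with [l] and [s] with [k]: the crossing that [crossing_counts]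
   requires. *)
have hB := peaks_coneighbors e' e b y r s l k eE e'E yE rP sP.
have := crossing_counts (e k) (e l) (e' r) (e' s) KL RS.
rewrite leqNgt -(ltr_nat R) !natrD => /negP; apply.
apply: (@peaks_incompatible _ _ a b) => //; [by rewrite ler_nat| |].
- by apply: hA => //; lra.
- by apply: hB => //; lra.
Qed.

Lemma eigenvalue_sum_ge1 {R : realFieldType} {T : finType}
    (e e' : rel T) (a b : R) (x y : T -> R) (i j : T) :
    co_rel e' e -> co_rel e e' -> symmetric e ->
    is_eigenfun e a x -> is_eigenfun e' b y -> x i != 0 -> y j != 0 ->
  1 <= a + b.
Proof.
move=> e'E eE esym xE yE xi yj.
have [a0 [k kP]] := peak_exists e a x i xE xi.
have [_ [l lP]] : 0 <= a /\ exists l, is_peak e a (\- x) l.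
  by apply: (@peak_exists _ _ _ _ _ i); [exact: is_eigenfunN|rewrite oppr_eq0].
have [b0 [r rP]] := peak_exists e' b y j yE yj.
have [_ [s sP]] : 0 <= b /\ exists l, is_peak e' b (\- y) l.
  by apply: (@peak_exists _ _ _ _ _ j); [exact: is_eigenfunN|rewrite oppr_eq0].
have T2 : (2 <= #|T|)%N.
  rewrite ltnNge; apply/negP => /card_le1_eqP T1; case: kP lP => + _ _ [+ _ _].
  by rewrite (T1 k l) //=; lra.
rewrite leNgt; apply/negP => ab.
suff : 1 <= a + b by rewrite leNgt ab.
(* If [k] is adjacent to [s] instead, replacing [y] by [\- y] exchanges [r] and [s]. *)
suff /orP[ekr|eks] : e k r || e k s.
- exact: (@eigenvalue_sum_ge1_adj _ _ e e' a b x y k l r s).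
- have rP' : is_peak e' b (\- \- y) r.
    by case: rP => h1 h2 h3; split=> [|v|v ev] /=; rewrite !opprK ?h1 ?h2 ?h3.
  apply: (@eigenvalue_sum_ge1_adj _ _ e e' a b x (\- y) k l s r) => //.
  exact: is_eigenfunN.
(* As [r] and [s] are adjacent, [k] may be assumed distinct from both. Adjacent to neither, it would
   be a neighbour of both in the complement, giving [y k] two opposite signs. *)
have [yr0 _ yR] := rP; have [ys0 _ yS] := sP; rewrite /= in ys0 yS.
have rs : e r s.
  rewrite e'E; apply/andP; split.
    by apply/eqP => rs; rewrite rs in yr0; lra.
  by apply/negP => /yR h; nra.
have [->|kr] := eqVneq k r; first by rewrite rs orbT.
have [->|ks] := eqVneq k s; first by rewrite esym rs.
have e'sym v w : e' v w = e' w v by rewrite !eE eq_sym esym.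
rewrite !e'E kr ks /= -negb_and !(e'sym k); apply/negP => /andP[/yR h1 /yS h2].
nra.
Qed.

(** * Spectrum of a real symmetric matrix *)

Lemma char_poly_conj {F : fieldType} {n : nat} (P D : 'M[F]_n) :
  P \in unitmx -> char_poly (invmx P *m D *m P) = char_poly D.
Proof.
move=> Pu; rewrite /char_poly /char_poly_mx !map_mxM /=.
have PP : map_mx polyC (invmx P) *m map_mx polyC P = 1%:M.
  by rewrite -map_mxM mulVmx // map_mx1.
have -> : 'X%:M - map_mx polyC (invmx P) *m map_mx polyC D *m map_mx polyC P
    = map_mx polyC (invmx P) *m ('X%:M - map_mx polyC D) *m map_mx polyC P.
  rewrite mulmxBr mulmxBl; congr (_ - _).
  by rewrite -mulmxA -scalar_mxC mulmxA PP mul1mx.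
by rewrite !det_mulmx mulrAC -det_mulmx PP det1 mul1r.
Qed.

Lemma mxrank_diag_leq {F : fieldType} {n : nat} (d : 'rV[F]_n) :
  (\rank (diag_mx d) <= \sum_(i < n) (d 0 i != 0)%R)%N.
Proof.
rewrite diag_mx_sum_delta; elim/big_ind2: _ => [|A p B q hA hB|i _].
- by rewrite mxrank0.
- exact: leq_trans (mxrank_add _ _) (leq_add hA hB).
- have [->|_] := eqVneq; first by rewrite scale0r mxrank0.
  by rewrite (leq_trans (mxrank_scale _ _)) // mxrank_delta.
Qed.

(** Over the complex numbers [M] is hermitian, hence diagonalizable with real spectrum. The rank
    bound says that the multiplicity of the root 0 is at most the dimension of the kernel. *)
Lemma symmetric_spectrum {R : rcfType} {n : nat} (M : 'M[R]_n) :
  M^T = M ->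
  exists s : seq R,
    [/\ sorted <=%R s, char_poly M = \prod_(x <- s) ('X - x%:P)
      & (\rank M <= count (predC1 0%R) s)%N].
Proof.
move=> Msym; pose C := real_complex R; pose MC := map_mx C M.
have MCherm : MC \is hermsymmx.
  apply: realsym_hermsym.
    by apply/is_hermitianmxP; rewrite expr0 scale1r map_mx_id // /MC map_trmx Msym.
  by apply/mxOverP => i j; rewrite mxE complex_real.
have /orthomx_spectralP ME := hermitian_normalmx MCherm.
have /mxOverP dreal := hermitian_spectral_diag_real MCherm.
pose d := map_mx (@complex.Re R) (spectral_diag MC).
have dE : spectral_diag MC = map_mx C d.
  by apply/rowP => i; rewrite !mxE; apply: esym (RRe_real _); exact: dreal.
have Pu := spectral_unit MC.
have MCchar : char_poly MC = char_poly (map_mx C (diag_mx d)).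
  by rewrite {1}ME char_poly_conj // dE map_diag_mx.
have Mchar : char_poly M = \prod_(i < n) ('X - (d 0 i)%:P).
  apply: (map_poly_inj C); rewrite map_char_poly MCchar -map_char_poly.
  congr map_poly; rewrite char_poly_trig ?diag_mx_is_trig //.
  by apply: eq_bigr => i _; rewrite mxE eqxx.
pose s0 := [seq d 0 i | i <- index_enum 'I_n].
exists (sort <=%R s0); split.
- exact/sort_sorted/le_total.
- by rewrite Mchar (perm_big s0) ?perm_sort // big_map.
rewrite (permP (permEl (perm_sort _ _))) count_map -sum1_count.
rewrite -(mxrank_map C) -/MC ME dE -map_diag_mx.
have := mxrank_diag_leq d; rewrite -(mxrank_map C) => h.
apply: leq_trans (mxrankM_maxl _ _) _; apply: leq_trans (mxrankM_maxr _ _) _.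
by apply: (leq_trans h); rewrite [leqRHS]big_mkcond /=; apply: leq_sum => i _; case: eqP.
Qed.

Definition nontrivial_eigenvalue {R : realFieldType} {n : nat} (M : 'M[R]_n)
    (a : R) :=
  exists x : 'rV_n, [/\ x != 0, \sum_i x 0 i = 0 & x *m M = a *: x].

(** Since [M] kills [e], eigenvectors for nonzero eigenvalues are orthogonal to [e]. Only a zero at
    a position [i > 0] needs a multiplicity argument. *)
Lemma nth_eigenvalues {R : realType} {n : nat} (M : 'M[R]_n) :
    M^T = M -> M *m const_mx 1 = 0 :> 'cV_n ->
    (forall a, nontrivial_eigenvalue M a -> 0 <= a) ->
  size (eigenvalues M) = n /\
  forall i, (0 < i < n)%N -> nontrivial_eigenvalue M (nth 0 (eigenvalues M) i).
Proof.
move=> Msym M1 Mpsd; have [s [ssorted schar srank]] := symmetric_spectrum M Msym.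
rewrite (eigenvalues_unique ssorted schar).
have sn : size s = n.
  by have := size_char_poly M; rewrite schar size_prod_XsubC => -[].
have nontriv a : a \in s -> a != 0 -> nontrivial_eigenvalue M a.
  move=> as_ a0; have /eigenvalueP[x xE x0] : eigenvalue M a.
    by rewrite eigenvalue_root_char schar root_prod_XsubC.
  exists x; split=> //.
  have /rowP/(_ 0) : x *m M *m const_mx 1 = 0 :> 'rV_1 by rewrite -mulmxA M1 mulmx0.
  rewrite xE -scalemxAl !mxE => /eqP; rewrite mulf_eq0 (negPf a0) /= => /eqP x1; rewrite -[RHS]x1.
  by apply: eq_bigr => i _; rewrite mxE mulr1.
split=> // i /andP[i0 ilt].
have [si0|] := eqVneq (nth 0 s i) 0; last by apply/nontriv/mem_nth; rewrite sn.
have s00 : nth 0 s 0 = 0.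
  apply/le_anti/andP; split.
    rewrite -[leRHS]si0; apply: sorted_leq_nth => //; rewrite ?inE ?sn //.
      exact: le_trans.
    exact: leq_ltn_trans ilt.
  have [->//|h] := eqVneq (nth 0 s 0) 0; apply/Mpsd/nontriv => //.
  by apply/mem_nth; rewrite sn (leq_ltn_trans _ ilt).
rewrite si0.
(* 0 is at least a double root, so M has rank at most n - 2 and a kernel vector
   can be chosen orthogonal to e. *)
have cnt : (count (predC1 0%R) s + 2 <= n)%N.
  rewrite -[leqRHS]sn -(count_predC (predC1 0%R) s) leq_add2l.
  move: ilt; rewrite -sn; move: i0 si0 s00; clear.
  case: s i => [|c s] [|i] //= _ si0 ->; rewrite ltnS => ilt.
  rewrite eqxx /= add1n ltnS -has_count; apply/hasP; exists 0 => //=.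
    by rewrite -si0 mem_nth.
  by rewrite eqxx.
(* A left kernel vector of [M] with the column [e] appended is at once in the kernel of [M] and
   orthogonal to [e]. *)
have : ~~ row_free (row_mx M (const_mx 1 : 'cV_n)).
  rewrite -row_leq_rank -ltnNge.
  rewrite -mxrank_tr tr_row_mx -addsmxE.
  apply: leq_ltn_trans (mxrank_adds_leqif _ _) _; rewrite mxrank_tr.
  apply: leq_ltn_trans (leq_add srank (rank_leq_row _)) _; by rewrite -addnS.
rewrite -kermx_eq0 => /rowV0Pn[x /sub_kermxP xM x0]; exists x.
move: xM; rewrite mul_mx_row -row_mx0 => /eq_row_mx[xM x1].
split; rewrite ?scale0r //.
have /rowP/(_ 0) := x1; rewrite !mxE => {}x1; rewrite -[RHS]x1.
by apply: eq_bigr => j _; rewrite mxE mulr1.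
Qed.

(** * Laplacian matrices of a graph and of its complement *)

Lemma row_mul_laplacian {R : realType} {n : nat} (M : 'M[R]_n) (x : 'rV_n)
    (j : 'I_n) :
  M^T = M -> (x *m laplacian M) 0 j = \sum_i M j i * (x 0 j - x 0 i).
Proof.
move=> Msym; rewrite mulmxBr mul_mx_diag !mxE mulr_sumr -sumrB.
by apply: eq_bigr => i _; rewrite -{2}Msym !mxE; ring.
Qed.

Lemma laplacian_sym {R : realType} {n : nat} (M : 'M[R]_n) :
  M^T = M -> (laplacian M)^T = laplacian M.
Proof. by move=> Msym; rewrite linearB /= tr_diag_mx Msym. Qed.

Lemma laplacian_mul_const {R : realType} {n : nat} (M : 'M[R]_n) :
  M^T = M -> laplacian M *m const_mx 1 = 0 :> 'cV_n.
Proof.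
move=> Msym; apply: trmx_inj; rewrite trmx_mul laplacian_sym // trmx0.
apply/rowP => j; rewrite row_mul_laplacian // !mxE.
by apply: big1 => i _; rewrite !mxE subrr mulr0.
Qed.

Lemma laplacian_eigenfun {R : realType} {n : nat} (M : 'M[R]_n) (a : R)
    (x : 'rV_n) :
    M^T = M -> zero_one_mx M -> \sum_i x 0 i = 0 ->
    x *m laplacian M = a *: x ->
  is_eigenfun (fun i j => M i j == 1) a (x 0).
Proof.
move=> Msym M01 x0 xM; split=> // i.
have /rowP/(_ i) := xM; rewrite row_mul_laplacian // mxE => <-.
rewrite big_mkcond /=; apply: eq_bigr => j _.
by case: (M01 i j) => ->; rewrite ?mul0r ?mul1r ?eqxx // eq_sym oner_eq0.
Qed.

Lemma nontrivial_eigenvalue_ge0 {R : realType} {n : nat} (M : 'M[R]_n) (a : R) :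
    M^T = M -> zero_one_mx M -> nontrivial_eigenvalue (laplacian M) a ->
  0 <= a.
Proof.
move=> Msym M01 [x [/rV0Pn[i xi] x0 xM]].
by have [] := peak_exists _ a (x 0) i (laplacian_eigenfun M a x Msym M01 x0 xM) xi.
Qed.

Lemma compl_mx_sym {R : realType} {n : nat} (M : 'M[R]_n) :
  M^T = M -> (compl_mx M)^T = compl_mx M.
Proof. by move=> Msym; rewrite !linearB /= trmx_const trmx1 Msym. Qed.

Lemma compl_mx_zero_one {R : realType} {n : nat} (M : 'M[R]_n) :
  zero_one_mx M -> zero_diag_mx M -> zero_one_mx (compl_mx M).
Proof.
move=> M01 Mdiag i j; rewrite !mxE; case: eqVneq => [->|_].
  by left; rewrite Mdiag !subrr.
by case: (M01 i j) => ->; [right|left]; rewrite subr0 ?subr0 ?subrr.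
Qed.

(** The eigenvector is unchanged, because [J] annihilates vectors of sum zero. *)
Lemma nontrivial_eigenvalue_compl {R : realType} {n : nat} (M : 'M[R]_n)
    (a : R) :
    M^T = M -> nontrivial_eigenvalue (laplacian M) a ->
  nontrivial_eigenvalue (laplacian (compl_mx M)) (n%:R - a).
Proof.
move=> Msym [x [xn0 x0 xM]]; exists x; split=> //; apply/rowP => j.
rewrite row_mul_laplacian; last exact: compl_mx_sym.
have /rowP/(_ j) := xM; rewrite row_mul_laplacian // !mxE mulrBl => <-.
have -> : n%:R * x 0 j = \sum_(i < n) (x 0 j - x 0 i).
  by rewrite sumrB x0 subr0 sumr_const card_ord mulr_natl.
rewrite -sumrB; apply: eq_bigr => i _; rewrite !mxE.
by case: eqVneq => [->|_] /=; ring.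
Qed.

Lemma nontrivial_eigenvalue_sum_ge1 {R : realType} {n : nat} (A : 'M[R]_n)
    (a b : R) :
    A^T = A -> zero_one_mx A -> zero_diag_mx A ->
    nontrivial_eigenvalue (laplacian A) a ->
    nontrivial_eigenvalue (laplacian (compl_mx A)) b ->
  1 <= a + b.
Proof.
move=> Asym A01 Adiag [x [/rV0Pn[i xi] x0 xE]] [y [/rV0Pn[j yj] y0 yE]].
pose e i j := A i j == 1; pose e' i j := compl_mx A i j == 1.
have e'E : co_rel e e'.
  move=> v w; rewrite /e /e' !mxE; case: (eqVneq v w) => [->|_] /=.
    by rewrite Adiag !subrr ?subr0 eq_sym oner_eq0.
  by case: (A01 v w) => ->; rewrite !subr0 ?subrr eqxx // eq_sym oner_eq0.
have eE : co_rel e' e.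
  move=> v w; rewrite e'E; case: (eqVneq v w) => [->|_] /=; last by rewrite negbK.
  by rewrite /e Adiag eq_sym oner_eq0.
apply: (@eigenvalue_sum_ge1 _ _ e e' a b (x 0) (y 0) i j) => //.
- by move=> v w; rewrite /e -{1}Asym mxE.
- exact: laplacian_eigenfun.
- by apply: laplacian_eigenfun => //; [exact: compl_mx_sym|exact: compl_mx_zero_one].
Qed.

Lemma mu_laplacian_nontrivial {R : realType} {n : nat} (M : 'M[R]_n) (k : nat) :
    M^T = M -> zero_one_mx M -> (0 < k < n)%N ->
  nontrivial_eigenvalue (laplacian M) (mu k (laplacian M)).
Proof.
move=> Msym M01 /andP[k0 kn].
have [sn nthE] := nth_eigenvalues (laplacian M) (laplacian_sym M Msym)
  (laplacian_mul_const M Msym) (fun a => nontrivial_eigenvalue_ge0 M a Msym M01).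
(* In the increasing list, indexed from 0, the [k]-th largest entry has position [n - k], which is
   positive. *)
rewrite /mu nth_rev sn prednK ?(ltnW kn) //; apply: nthE.
by rewrite subn_gt0 kn ltn_subrL k0 (ltn_trans k0).
Qed.

Theorem theorem3p3 (R : realType) (n : nat) (n_ge2 : (2 <= n)%N) (A : 'M[R]_n)
    (A_sym : A^T = A) (A_01 : zero_one_mx A) (A_diag : zero_diag_mx A) :
  alpha A + alpha (compl_mx A) >= 1 /\
  beta A - alpha A <= n%:R - 1.
Proof.
have AC_sym := compl_mx_sym A A_sym.
have AC_01 := compl_mx_zero_one A A_01 A_diag.
have n1 : (0 < n.-1 < n)%N.
  by rewrite -subn1 subn_gt0 n_ge2 ltn_subrL /= (ltnW n_ge2).
have alphaA := mu_laplacian_nontrivial A n.-1 A_sym A_01 n1.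
have alphaAC := mu_laplacian_nontrivial (compl_mx A) n.-1 AC_sym AC_01 n1.
have betaA := mu_laplacian_nontrivial A 1 A_sym A_01 n_ge2.
have sum_ge1 b := nontrivial_eigenvalue_sum_ge1 A _ b A_sym A_01 A_diag alphaA.
split; first exact: sum_ge1 alphaAC.
(* Here [b] is [n%:R - beta A], which turns the sum bound into the second claim. *)
have := sum_ge1 _ (nontrivial_eigenvalue_compl A _ A_sym betaA).
rewrite /alpha /beta; lra.
Qed.
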